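(* For $v\in\mathcal{V}$ put $$J[v]:=\int_P\{v'_+(a)(a-H[X_k])-v(a)\}\,\mathbb{Q}(da\times dk)+\int_N\{v'_-(a)(a-H[X_k])-v(a)\}\,\mathbb{Q}(da\times dk),$$ where $P:=\{(a,k)\in\mathcal{T}:a\ge H[X_k]\}$ and $N:=\{(a,k)\in\mathcal{T}:a<H[X_k]\}$; for $t\in[0,\infty]$ let $\phi_t(\cdot)=(\cdot-t)_+$, and let $\tau^*:=\arg\max_{t\in[0,\infty]}J[\phi_t]$. For the problem of maximizing $$J[M]=\int_{\mathcal{T}}\{\lambda_{(a,k)}(a-H[X_k])-v(a)\}\,\mathbb{Q}(da\times dk)$$ over all quota-share menus $M=\{v,\lambda_{(a,k)}\}\in\mathcal{M}_2$ (i.e. $v\in\mathcal{V}$, $\lambda_{(a,k)}\in\partial v(a)$ for all $(a,k)\in\mathbb{R}_+\times K$), the optimal coinsurance rate $\lambda^*_{(a,k)}$ and the premium $P^*_{(a,k)}$ corresponding to the quota-share policy with such coinsurance rate are given respectively by $$\lambda^*_{(a,k)}=\begin{cases}1 & \text{if }a>\tau^*\\ 1 & \text{if }a=\tau^*\ge H[X_k]\\ 0 & \text{if }a=\tau^*<H[X_k]\\ 0 & \text{if }a<\tau^*,\end{cases}\qquad P^*_{(a,k)}=\begin{cases}\tau^* & \text{if }a>\tau^*\\ \tau^* & \text{if }a=\tau^*\ge H[X_k]\\ 0 & \text{if }a=\tau^*<H[X_k]\\ 0 & \text{if }a<\tau^*.\end{cases}$$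
   Context: Setting. $\mathbb{R}_+=[0,\infty)$, $\overline{\mathbb{R}}_+=[0,\infty]$, $(x-\infty)_+=0$. $K$ is a Polish space with its Borel $\sigma$-algebra. For each $k\in K$, $X_k$ is a nonnegative random variable (loss) with distribution function $F_k$ that is strictly increasing and continuous on its support, with possibly a jump at $0$; $\overline{F}_k=1-F_k$. $\tilde{\mathcal{T}}\subset(0,1)\times K$ is a measurable set whose projection onto $K$ is all of $K$, with $\alpha<1-F_k(0)$ for all $(\alpha,k)\in\tilde{\mathcal{T}}$, and $\mathrm{VaR}_\alpha(X_k)=\overline{F}_k^{-1}(\alpha)$. The (injective) map $\iota(\alpha,k)=(\mathrm{VaR}_\alpha(X_k),k)$ from $\tilde{\mathcal{T}}$ to $\mathbb{R}_+\times K$ is assumed measurable; $\mathcal{T}:=\iota(\tilde{\mathcal{T}})$ is the (measurable) set of types $(a,k)$. $\tilde{\mathbb{Q}}$ is a probability measure on $\tilde{\mathcal{T}}$ and $\mathbb{Q}=\tilde{\mathbb{Q}}\circ\iota^{-1}$ is its image on $\mathbb{R}_+\times K$, so $\mathbb{Q}$ is concentrated on $\mathcal{T}$. $H:\mathcal{X}\to\mathbb{R}$ is a cost functional on a domain $\mathcal{X}$ of random variables containing all $X_k$; $H$ is monotone, convex, comonotonic additive, satisfies $H[X]\ge 0$ for nonnegative $X$ with $H[X]=0$ only if $X=0$ a.s., and $H[1]=1+\theta>1$. Menus. $\mathcal{V}$ is the collection of all increasing (non-decreasing), convex, 1-Lipschitz functions on $\mathbb{R}_+$ that vanish at $0$.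 $v'_\pm$ denote one-sided derivatives, with the convention $v'_-(0)=0$, and $\partial v(a)=[v'_-(a),v'_+(a)]$. $\mathcal{M}_2$ is the collection of feasible quota-share menus $M=\{v,\lambda_{(a,k)}\}$: $v\in\mathcal{V}$ (indirect utility), coinsurance rates $\lambda_{(a,k)}\in[0,1]$ for $(a,k)\in\mathbb{R}_+\times K$ (the indemnity for type $(a,k)$ is $I_{(a,k)}(x)=\lambda_{(a,k)}x$), satisfying the incentive compatibility constraints $v(a')-v(a)\ge\lambda_{(a,k)}(a'-a)$ for all $a'\in\mathbb{R}_+$, equivalently $\lambda_{(a,k)}\in\partial v(a)$. The premium of the policy for type $(a,k)$ is $P_{(a,k)}=I_{(a,k)}(a)-v(a)$; the optimal menu has indirect utility $\phi_{\tau^*}$. Only menus for which the integrand of the objective is measurable and integrable are considered. ($\tau^*=\arg\max$ means that $\tau^*$ is a point at which the maximum is attained.) *)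

(* Defs.v *)
From HB Require Import structures.
From mathcomp Require Import all_boot all_order all_algebra.
From mathcomp Require Import all_classical all_reals all_analysis.
From mathcomp Require Import ring lra.

Set Implicit Arguments.
Unset Strict Implicit.
Unset Printing Implicit Defensive.

Import Order.TTheory GRing.Theory Num.Theory.
Import numFieldNormedType.Exports.

Local Open Scope classical_set_scope.
Local Open Scope ring_scope.

(** * Polish spaces and their Borel sigma-algebra *)

Definition polish_space (R : realType) (K : topologicalType) : Prop :=
  (exists2 S : set K, countable S & dense S) /\
  exists D : K -> K -> R,
    [/\ forall x y, 0 <= D x y /\ (D x y = 0 <-> x = y),
        forall x y, D x y = D y x,
        forall x y z, D x z <= D x y + D y z,
        forall A : set K, open A <->
          (forall x, A x -> exists2 e, 0 < e & forall y, D x y < e -> A y) &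
        forall u : nat -> K,
          (forall e, 0 < e -> exists N : nat, forall m n : nat,
            (N <= m)%N -> (N <= n)%N -> D (u m) (u n) < e) ->
          exists l, forall e, 0 < e -> exists N : nat, forall n : nat,
            (N <= n)%N -> D (u n) l < e].

Notation borel K := (g_sigma_algebraType (@open K)).

(** * Losses *)

Section Losses.
Context d (Om : measurableType d) (R : realType) (Pr : probability Om R).

(* The smallest closed set of full measure for the law of [X]. *)
Definition law_support (X : {RV Pr >-> R}) : set R :=
  [set x | forall e : R, 0 < e -> (0 < distribution Pr X (ball x e))%E].

Definition regular_loss (X : {RV Pr >-> R}) : Prop :=
  [/\ {ae Pr, forall w, 0 <= X w},
      forall x y, law_support X x -> law_support X y -> x < y ->
        (cdf X x < cdf X y)%E &
      forall x, law_support X x -> x != 0 -> {for x, continuous (cdf X)}].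

(* The (generalized) inverse at [alpha] of the survival function. *)
Definition VaR (X : {RV Pr >-> R}) (alpha : R) : R :=
  inf [set x : R | (ccdf X x <= alpha%:E)%E].

Definition comonotonic (X Y : Om -> R) : Prop :=
  exists A : set Om, [/\ measurable A, Pr A = 1%E &
    forall w w', A w -> A w' -> 0 <= (X w - X w') * (Y w - Y w')].

(* [dom] is the domain of the functional; the values of [H] off [dom] are
   never constrained.  Inequalities between random variables hold a.s. *)
Record cost_functional (dom : set (Om -> R)) (H : (Om -> R) -> R) (theta : R)
    : Prop := {
  cost_dom_rv : forall X, dom X -> measurable_fun setT X ;
  cost_monotone : forall X Y, dom X -> dom Y ->
    {ae Pr, forall w, X w <= Y w} -> H X <= H Y ;
  cost_convex : forall X Y (t : R), dom X -> dom Y -> 0 <= t <= 1 ->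
    dom (fun w => t * X w + (1 - t) * Y w) ->
    H (fun w => t * X w + (1 - t) * Y w) <= t * H X + (1 - t) * H Y ;
  cost_comonotonic_additive : forall X Y, dom X -> dom Y ->
    dom (fun w => X w + Y w) -> comonotonic X Y ->
    H (fun w => X w + Y w) = H X + H Y ;
  cost_ge0 : forall X, dom X -> {ae Pr, forall w, 0 <= X w} -> 0 <= H X ;
  cost_eq0 : forall X, dom X -> {ae Pr, forall w, 0 <= X w} -> H X = 0 ->
    {ae Pr, forall w, X w = 0} ;
  cost_dom1 : dom (cst 1) ;
  cost_one : H (cst 1) = 1 + theta ;
  cost_loading : 1 < 1 + theta }.

Definition type_of (K : Type) (X : K -> {RV Pr >-> R}) (z : R * K) : R * K :=
  (VaR (X z.2) z.1, z.2).

End Losses.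

(** * Indirect utilities *)

Section IndirectUtility.
Context (R : realType).
Implicit Types (v : R -> R) (a : R).

(* Functions on [0, +oo[ are represented by functions on [R]; their values at
   negative arguments play no role. *)
Definition indirect_utility v : Prop :=
  [/\ {in `[0, +oo[ &, {homo v : x y / x <= y}},
      convex_function (`[0, +oo[%classic : set R) v,
      1.-lipschitz_(`[0, +oo[%classic) v &
      v 0 = 0].

Definition rderiv v a : R := lim ((v (a + h) - v a) / h @[h --> 0^'+]).

Definition lderiv v a : R :=
  if a == 0 then 0 else lim ((v (a + h) - v a) / h @[h --> 0^'-]).

Definition subdifferential v a : set R := `[lderiv v a, rderiv v a]%classic.

Definition phi (t : \bar R) (x : R) : R :=
  if t is r%:E then Num.max (x - r) 0 else 0.

End IndirectUtility.

(** * Quota-share menus *)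

Section Menus.
Context (R : realType) (K : Type).
Implicit Types (v : R -> R) (lam : R * K -> R) (h : K -> R).

Definition indemnity lam (z : R * K) (x : R) : R := lam z * x.

Definition premium v lam (z : R * K) : R := indemnity lam z z.1 - v z.1.

(* See [incentive_compatibleP] for the incentive compatibility constraints. *)
Definition quota_share_menu v lam : Prop :=
  indirect_utility v /\
  forall a k, 0 <= a ->
    0 <= lam (a, k) <= 1 /\ subdifferential v a (lam (a, k)).

(* In what follows [h k] stands for H[X_k]. *)
Definition profit h v lam (z : R * K) : R :=
  lam z * (z.1 - h z.2) - v z.1.

Definition pointwise_best_rate h v (z : R * K) : R :=
  if h z.2 <= z.1 then rderiv v z.1 else lderiv v z.1.

Definition optimal_rate h (tau : \bar R) (z : R * K) : R :=
  if (tau < z.1%:E)%E then 1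
  else if z.1%:E == tau then (if h z.2 <= z.1 then 1 else 0)
  else 0.

Definition optimal_premium h (tau : \bar R) (z : R * K) : \bar R :=
  if (tau < z.1%:E)%E then tau
  else if z.1%:E == tau then (if h z.2 <= z.1 then tau else 0%E)
  else 0%E.

End Menus.

Section Objective.
Context d (K : measurableType d) (R : realType).
Context (Q : set (R * K) -> \bar R) (T : set (R * K)) (h : K -> R).
Local Open Scope ereal_scope.

Definition admissible (v : R -> R) (lam : R * K -> R) : Prop :=
  Q.-integrable T (EFin \o profit h v lam).

Definition J_menu (v : R -> R) (lam : R * K -> R) : \bar R :=
  \int[Q]_(z in T) (profit h v lam z)%:E.

Definition J (v : R -> R) : \bar R :=
  \int[Q]_(z in [set z | T z /\ (h z.2 <= z.1)%R])
    (rderiv v z.1 * (z.1 - h z.2) - v z.1)%:E +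
  \int[Q]_(z in [set z | T z /\ (z.1 < h z.2)%R])
    (lderiv v z.1 * (z.1 - h z.2) - v z.1)%:E.

End Objective.

(** * Incentive compatibility *)

Section IncentiveCompatibility.
Context (R : realType) (v : R -> R) (Vv : indirect_utility v).
Local Notation slope a := (fun h : R => (v (a + h) - v a) / h).

Let lip (x y : R) : 0 <= x -> 0 <= y -> `|v x - v y| <= `|x - y|.
Proof.
case: Vv => _ _ vlip _ x0 y0.
have /= := vlip (x, y); rewrite mul1r; apply.
by split; rewrite /= in_itv/= andbT.
Qed.

Let cvx (x y p : R) : 0 <= x -> 0 <= y -> 0 <= p <= 1 ->
  v (p * x + (1 - p) * y) <= p * v x + (1 - p) * v y.
Proof.
case: Vv => _ vc _ _ x0 y0 /andP[p0 p1].
have := vc (Itv01 p0 p1) x y; rewrite !inE/= !in_itv/= !andbT => /(_ x0 y0).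
by rewrite !convRE.
Qed.

Let slope_le1 a h : 0 <= a -> 0 <= a + h -> `|slope a h| <= 1.
Proof.
move=> a0 ah0 /=; rewrite normrM normfV.
have [->|h0] := eqVneq h 0; first by rewrite normr0 invr0 mulr0.
rewrite ler_pdivrMr ?normr_gt0// mul1r.
by rewrite (le_trans (lip ah0 a0))// addrAC subrr add0r.
Qed.

Let slope_ndr a h1 h2 : 0 <= a -> 0 < h1 -> h1 <= h2 ->
  slope a h1 <= slope a h2.
Proof.
move=> a0 h10 h12 /=; have h20 : 0 < h2 by exact: lt_le_trans h12.
have p01 : 0 <= h1 / h2 <= 1.
  apply/andP; split; first by rewrite divr_ge0// ltW.
  by rewrite ler_pdivrMr// mul1r.
have /= := @cvx (a + h2) a _ (addr_ge0 a0 (ltW h20)) a0 p01.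
have -> : h1 / h2 * (a + h2) + (1 - h1 / h2) * a = a + h1.
  by field; rewrite gt_eqF.
rewrite ler_pdivrMr// => H.
have -> : (v (a + h2) - v a) / h2 * h1 = h1 / h2 * (v (a + h2) - v a).
  by field; rewrite gt_eqF.
by nra.
Qed.

Let slope_ndl a h1 h2 : 0 <= a + h1 -> h1 <= h2 -> h2 < 0 ->
  slope a h1 <= slope a h2.
Proof.
move=> a0 h12 h20 /=; have h10 : h1 < 0 by exact: le_lt_trans h20.
have p01 : 0 <= h2 / h1 <= 1.
  apply/andP; split; last by rewrite ler_ndivrMr// mul1r.
  by rewrite -mulrNN -invrN divr_ge0// oppr_ge0 ltW.
have a0' : 0 <= a by lra.
have /= := @cvx (a + h1) a _ a0 a0' p01.
have -> : h2 / h1 * (a + h1) + (1 - h2 / h1) * a = a + h2.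
  by field; rewrite lt_eqF.
rewrite ler_ndivlMr// => H.
have -> : (v (a + h1) - v a) / h1 * h2 = h2 / h1 * (v (a + h1) - v a).
  by field; rewrite lt_eqF.
by nra.
Qed.

Lemma cvg_rderiv a : 0 <= a -> cvg (slope a h @[h --> 0^'+]).
Proof.
move=> a0; apply: nondecreasing_at_right_is_cvgr.
  near=> x => h1 h2; rewrite !in_itv/= => /andP[h10 _] /andP[h20 _] h12.
  exact: slope_ndr.
apply: nearW => x; exists (-1) => y [h /=]; rewrite in_itv/= => /andP[h0 _] <-.
have := @slope_le1 a h a0 (addr_ge0 a0 (ltW h0)).
by rewrite ler_norml => /andP[].
Unshelve. all: by end_near. Qed.

Lemma cvg_lderiv a : 0 < a -> cvg (slope a h @[h --> 0^'-]).
Proof.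
move=> a0; apply: nondecreasing_at_left_is_cvgr.
  near=> x => h1 h2; rewrite !in_itv/= => /andP[h10 _] /andP[h20 h20'] h12.
  apply: slope_ndl => //.
  suff : - a < x by lra.
  by near: x; apply: nbhs_left_gt; rewrite oppr_lt0.
near=> x; exists 1 => y [h /=]; rewrite in_itv/= => /andP[xh h0] <-.
have ah : 0 <= a + h.
  suff : - a < x by lra.
  by near: x; apply: nbhs_left_gt; rewrite oppr_lt0.
by have := @slope_le1 a h (ltW a0) ah; rewrite ler_norml => /andP[].
Unshelve. all: by end_near. Qed.

Lemma incentive_compatibleP (a l : R) : 0 <= a -> 0 <= l ->
  subdifferential v a l <->
  forall a', 0 <= a' -> l * (a' - a) <= v a' - v a.
Proof.
move=> a0 l0; rewrite /subdifferential /= in_itv/=; split.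
  move=> /andP[ll lr] a' a'0.
  have [aa'|a'a|->] := ltgtP a a'; last by rewrite !subrr mulr0.
  - rewrite -ler_pdivlMr ?subr_gt0//; apply: (le_trans lr).
    have -> : v a' = v (a + (a' - a)) by rewrite subrKC.
    apply: limr_le; first exact: cvg_rderiv.
    near=> h; apply: slope_ndr => //; near: h.
    by apply: nbhs_right_le; rewrite subr_gt0.
  - rewrite -ler_ndivrMr ?subr_lt0//; apply: le_trans ll.
    have -> : v a' = v (a + (a' - a)) by rewrite subrKC.
    have a_gt0 : 0 < a by exact: le_lt_trans a'a.
    rewrite /lderiv gt_eqF//; apply: limr_ge; first exact: cvg_lderiv.
    near=> h; apply: slope_ndl; first by rewrite subrKC.
      by near: h; apply: nbhs_left_ge; rewrite subr_lt0.
    by near: h; exact: nbhs_left_lt.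
move=> ic; apply/andP; split.
  rewrite /lderiv; case: eqVneq => // aneq0.
  have a_gt0 : 0 < a by rewrite lt_neqAle eq_sym aneq0.
  apply: limr_le; first exact: cvg_lderiv.
  near=> h; have h0 : h < 0 by near: h; exact: nbhs_left_lt.
  have ah : 0 <= a + h.
    suff : - a < h by lra.
    by near: h; apply: nbhs_left_gt; rewrite oppr_lt0.
  by rewrite ler_ndivrMr//; have := ic _ ah; rewrite addrAC subrr add0r.
apply: limr_ge; first exact: cvg_rderiv.
near=> h; have h0 : 0 < h by near: h; exact: nbhs_right_gt.
rewrite ler_pdivlMr//; have := ic _ (addr_ge0 a0 (ltW h0)).
by rewrite addrAC subrr add0r.
Unshelve. all: by end_near. Qed.

End IncentiveCompatibility.

(* Main.v *)
Require Import Defs.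
From mathcomp Require Import all_boot all_order all_algebra.
From mathcomp Require Import all_classical all_reals all_analysis.
From mathcomp Require Import measurable_realfun.
From mathcomp Require Import ring lra.

Import Order.TTheory GRing.Theory Num.Theory.
Import numFieldNormedType.Exports.

Local Open Scope classical_set_scope.
Local Open Scope ring_scope.

(* The family of stop-loss utilities [phi t] consists of the extreme points of the
   indirect utilities: a convex 1-Lipschitz [v] with [v 0 = 0] is a mixture of
   the [phi t], and [J] is linear along the mixture, so [J v <= max_t J (phi t)].
   The mixture is discretised here: with [t_i] a point where [i / n] is a
   subgradient of [v] ([+oo] if there is none), the profit of any menu built on
   [v] is at most the average over [i < n] of the profits of the [phi t_i], up
   to an error [(a + 2 H[X_k]) / n].  As [a] need not be integrable the error is
   removed by dominated convergence of its positive part: the stop-loss profits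
   are [>= - H[X_k]], so this part is also at most |profit| + H[X_k]. *)

Ltac case_max := repeat match goal with
  | |- context [Order.max ?x ?y] => case: (leP x y) => ? end.

(** * Stop-loss utilities: derivatives, rates, profits and premiums *)

Section StopLoss.
Context (R : realType).
Implicit Types (t : \bar R) (a x : R).

Lemma phi_indirect_utility t : (0 <= t)%E -> indirect_utility (phi t).
Proof.
case: t => [r| |//] r0; rewrite ?lee_fin in r0; split => /=.
- by move=> x y _ _ xy; case_max; lra.
- move=> p /= x y _ _; rewrite convRE.
  change (Num.max (p%:num * x + (1 - p%:num) * y - r) 0 <=
    p%:num * Num.max (x - r) 0 + (1 - p%:num) * Num.max (y - r) 0).
  have p0 : 0 <= p%:num by [].
  have p1 : p%:num <= 1 by [].
  move: (p%:num) p0 p1 => q q0 q1; case_max; nra.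
- move=> [x y] /= _; rewrite mul1r ler_norml.
  have := ler_norm (x - y); have := ler_norm (y - x); rewrite distrC.
  by move: `|x - y| => e ? ?; apply/andP; split; case_max; lra.
- by case_max; lra.
- by move=> *.
- by move=> p x y _ _; rewrite convRE !mulr0 addr0.
- by move=> [x y] /= _; rewrite subrr normr0 mul1r.
- by [].
Qed.

Lemma rderiv_phi t a : (0 <= t)%E ->
  rderiv (phi t) a = if (t <= a%:E)%E then 1 else 0.
Proof.
rewrite /rderiv; case: t => [r| |//] _ /=; last first.
  by apply: lim_near_cst => //; near=> h; rewrite subrr mul0r.
rewrite lee_fin; case: leP => ra; apply: lim_near_cst => //; near=> h.
- have h0 : 0 < h by near: h; exact: nbhs_right_gt.
  by rewrite (_ : _ - _ = h) ?divff ?gt_eqF//; case_max; lra.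
- have : h < r - a by near: h; apply: nbhs_right_lt; rewrite subr_gt0.
  by move=> har; rewrite (_ : _ - _ = 0) ?mul0r//; case_max; lra.
Unshelve. all: by end_near. Qed.

Lemma lderiv_phi t a : (0 <= t)%E -> 0 <= a ->
  lderiv (phi t) a = if (t < a%:E)%E then 1 else 0.
Proof.
(* The convention of left derivative [0] at the origin agrees with the formula, since [t < 0] is
   impossible. *)
move=> t0 a0; rewrite /lderiv; case: eqVneq => [->|_]; first by rewrite ltNge t0.
case: t t0 => [r| |//] _ /=; last first.
  by apply: lim_near_cst => //; near=> h; rewrite subrr mul0r.
rewrite lte_fin; case: ltP => ra; apply: lim_near_cst => //; near=> h.
- have h0 : h < 0 by near: h; exact: nbhs_left_lt.
  have : r - a < h by near: h; apply: nbhs_left_gt; rewrite subr_lt0.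
  by move=> har; rewrite (_ : _ - _ = h) ?divff ?lt_eqF//; case_max; lra.
- have h0 : h < 0 by near: h; exact: nbhs_left_lt.
  by rewrite (_ : _ - _ = 0) ?mul0r//; case_max; lra.
Unshelve. all: by end_near. Qed.

Context (K : Type) (h : K -> R).
Implicit Types z : R * K.

(** The one-sided derivatives of [phi t] differ only at [t], so the cost decides the rate only for a
    type equal to the deductible. *)
Lemma pointwise_best_rate_phi t z : (0 <= t)%E -> 0 <= z.1 ->
  pointwise_best_rate h (phi t) z = optimal_rate h t z.
Proof.
move=> t0 z0; rewrite /pointwise_best_rate /optimal_rate rderiv_phi// lderiv_phi//.
by case: (ltgtP t z.1%:E) => _; case: ifP.
Qed.

Lemma optimal_rate01 t z : 0 <= optimal_rate h t z <= 1.
Proof. by rewrite /optimal_rate; do !case: ifP => _; rewrite ?lexx ?ler01. Qed.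

Lemma optimal_rate_menu t : (0 <= t)%E ->
  quota_share_menu (phi t) (optimal_rate h t).
Proof.
move=> t0; have Vphi := phi_indirect_utility t t0; split=> // a k a0.
have r01 := optimal_rate01 t (a, k); split=> //; case/andP: (r01) => r0 _.
apply/incentive_compatibleP => // x x0; rewrite /optimal_rate/=.
case: t t0 {Vphi r01 r0} => [r| |//] r0; last by rewrite !mul0r subrr.
rewrite lte_fin eqe/=; case: ltgtP => ra; rewrite ?mul1r ?mul0r; try (case_max; lra).
by case: ifP => _; rewrite ?mul1r ?mul0r; case_max; lra.
Qed.

(** Under full cover the type cancels against [phi r]: a buyer brings the premium [r] minus the
    cost, and a non-buyer brings [0]. *)
Lemma profit_phi (r : R) z :
  profit h (phi r%:E) (optimal_rate h r%:E) z =
  optimal_rate h r%:E z * (r - h z.2).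
Proof.
rewrite /profit /optimal_rate lte_fin eqe/=.
case: ltgtP => ra; rewrite ?mul1r ?mul0r; try (case_max; lra).
by case: ifP => _; rewrite ?mul1r ?mul0r; case_max; lra.
Qed.

Lemma profit_phi_pinfty z :
  profit h (phi +oo%E) (optimal_rate h +oo%E) z = 0.
Proof. by rewrite /profit /optimal_rate/= mul0r subrr. Qed.

Lemma premium_phi t z : (0 <= t)%E ->
  (premium (phi t) (optimal_rate h t) z)%:E = optimal_premium h t z.
Proof.
rewrite /premium /indemnity /optimal_premium /optimal_rate.
case: t => [r| |//] _ /=; last by rewrite mul0r subrr.
rewrite lte_fin eqe; case: ltgtP => ra; rewrite ?mul1r ?mul0r.
- by congr _%:E; case_max; lra.
- by congr _%:E; case_max; lra.
- by case: ifP => _; rewrite ?mul1r ?mul0r; congr _%:E; case_max; lra.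
Qed.

End StopLoss.

(** * Comparing one indirect utility with an average of stop-loss utilities *)

Section Averaging.
Context (R : realType).
Implicit Types (v : R -> R) (a x l : R) (n i : nat).

(** Up to the factor [n], these are the points where the convex conjugate of [v] at slope [i / n] is
    attained. *)
Definition tangency v n i : set R :=
  [set r | 0 <= r /\
    forall x, 0 <= x -> n%:R * v r - i%:R * r <= n%:R * v x - i%:R * x].

(** The choice does not depend on the type, so each deductible defines a single menu for all types;
    the default [+oo] sells nothing. *)
Definition deductible v n i : \bar R :=
  xget +oo%E (EFin @` tangency v n i).

Lemma deductible_cases v n i : deductible v n i = +oo%E \/
  exists2 r, deductible v n i = r%:E & tangency v n i r.
Proof.
rewrite /deductible; case: xgetP => [_ _ [r rP <-]|_]; last by left.
by right; exists r.
Qed.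

Lemma deductible_ge0 v n i : (0 <= deductible v n i)%E.
Proof. by case: (deductible_cases v n i) => [->|[r -> []]]. Qed.

Section Subgradient.
Context v (Vv : indirect_utility v) a l (a0 : 0 <= a)
  (vl : forall x, 0 <= x -> l * (x - a) <= v x - v a).

(** Subgradients are monotone: a slope [i / n] below the slope [l] at [a] cannot be attained to the
    right of [a]. *)
Lemma tangency_le n i r : i%:R < n%:R * l -> tangency v n i r -> r <= a.
Proof.
move=> il [r0 /(_ a a0) ra]; rewrite leNgt; apply/negP => ar.
have := vl r r0; have : 0 <= n%:R :> R by []; nra.
Qed.

Lemma tangency_ge n i r : n%:R * l < i%:R -> tangency v n i r -> a <= r.
Proof.
move=> il [r0 /(_ a a0) ra]; rewrite leNgt; apply/negP => ar.
have := vl r r0; have : 0 <= n%:R :> R by []; nra.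
Qed.

(** As [i / n < l], the tilted function stays above its value at [a] beyond [a], so its minimum over
    the compact [[0, a]] is global. *)
Lemma tangency_nonempty n i : i%:R < n%:R * l -> tangency v n i !=set0.
Proof.
move=> il; pose f x := n%:R * v x - i%:R * x.
have cf : {within `[0, a], continuous f}.
  have [_ _ vlip _] := Vv.
  apply/subspace_continuousP => x /=; rewrite in_itv/= => /andP[x0 xa].
  apply/cvgrPdist_le => e e0; rewrite near_withinE; near=> y => /=.
  rewrite in_itv/= => /andP[y0 ya].
  have vxy : `|v x - v y| <= `|x - y|.
    have /= := vlip (x, y); rewrite mul1r; apply.
    by split; rewrite /= in_itv/= andbT.
  (* [f] is Lipschitz with constant [n + i]; the successor keeps the divisor positive. *)
  have xy : `|x - y| <= e / (n + i).+1%:R.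
    by near: y; apply: cvgr_dist_le; [exact: cvg_id|exact: divr_gt0].
  rewrite (_ : f x - f y = n%:R * (v x - v y) - i%:R * (x - y)); last first.
    by rewrite /f; ring.
  rewrite (le_trans (ler_normB _ _))// !normrM !normr_nat.
  rewrite ler_pdivlMr// -natr1 natrD in xy.
  have : 0 <= n%:R :> R by []; have : 0 <= i%:R :> R by [].
  have := normr_ge0 (x - y); nra.
have [r /[!in_itv]/= /andP[r0 ra] rmin] := EVT_min a0 cf.
exists r; split=> // x x0; have [xa|ax] := leP x a.
  by apply: rmin; rewrite in_itv/= x0.
have := rmin a; rewrite in_itv/= a0 lexx => /(_ isT); rewrite /f => fra.
have := vl x x0; have : 0 <= n%:R :> R by []; nra.
Unshelve. all: by end_near. Qed.

Context (K : Type) (h : K -> R) (k : K).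
Hypotheses (h0 : 0 <= h k).
Local Notation c n i :=
  (profit h (phi (deductible v n i))
    (optimal_rate h (deductible v n i)) (a, k)).

Lemma profit_deductible_lt n i : i%:R < n%:R * l ->
  exists2 r, tangency v n i r & r - h k <= c n i.
Proof.
move=> il; have [r0 r0P] := tangency_nonempty n i il.
rewrite /deductible; case: xgetP => [_ _ [r rP <-]|/(_ r0%:E)[]]; last by exists r0.
exists r => //; have ra := tangency_le _ _ _ il rP.
rewrite profit_phi /optimal_rate lte_fin eqe/=; move: ra.
(* At the tie [r = a] the rate is [0] only if [a < h k], and then the profit [0] still exceeds
   [r - h k]. *)
by rewrite le_eqVlt => /predU1P[->|->]; rewrite ?ltxx ?eqxx ?mul1r//; case: ifP; lra.
Qed.

Lemma profit_deductible_ge n i : - h k <= c n i.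
Proof.
case: (deductible_cases v n i) => [->|[r -> [r0 _]]].
  by rewrite profit_phi_pinfty oppr_le0.
rewrite profit_phi; have /andP[] := optimal_rate01 _ _ h r%:E (a, k).
move: (optimal_rate _ _ _) => q /= q0 q1.
have : 0 <= q * r by rewrite mulr_ge0.
have : 0 <= (1 - q) * h k by rewrite mulr_ge0// subr_ge0.
lra.
Qed.

(** A type below the deductible buys nothing, and a type equal to it gets rate [1] only if the
    premium covers the cost. *)
Lemma profit_deductible_gt n i : n%:R * l < i%:R -> 0 <= c n i.
Proof.
move=> il; case: (deductible_cases v n i) => [->|[r -> rP]].
  by rewrite profit_phi_pinfty.
have ra := tangency_ge _ _ _ il rP.
rewrite profit_phi /optimal_rate lte_fin eqe/= ltNge ra/=.
by case: eqP => [<-|_]; [case: ifP|]; lra.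
Qed.

(* [i x / n - v x] is maximal over [x >= 0] at the [i]-th deductible [r], and
   raising the slope from [(i - 1) / n] to [i / n] adds [r / n] there. *)
Lemma conjugate_le_sum n m : (forall i, (i < m)%N -> i%:R < n%:R * l) ->
  forall x, 0 <= x ->
  m%:R * x - x - n%:R * v x <= \sum_(i < m) c n i + m%:R * h k.
Proof.
elim: m => [|m IH] iml x x0.
  have [vh _ _ v0] := Vv; rewrite big_ord0 !mul0r.
  have : 0 <= v x by rewrite -v0; apply: vh; rewrite ?in_itv/= ?andbT.
  by have : 0 <= n%:R :> R by []; nra.
have [r [r0 /(_ x x0) rx] rc] := profit_deductible_lt n m (iml _ (ltnSn m)).
have := IH (fun i im => iml i (ltnW im)) r r0.
by rewrite big_ord_recr/= -natr1; nra.
Qed.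

(** Let [m] be the ceiling of [n l]. The error [a] comes from [conjugate_le_sum], one [h k] from
    [m <= n l + 1], and the other from the index [m], where [n l = m] is possible. *)
Lemma profit_le_average n : 0 <= l <= 1 ->
  n%:R * (l * (a - h k) - v a) <= \sum_(i < n) c n i + (a + 2 * h k).
Proof.
move=> /andP[l0 l1].
have nl : exists m, n%:R * l <= m%:R by exists n; rewrite ler_piMr.
case: (ex_minnP nl) => m nlm mmin.
have mn : (m <= n)%N by apply: mmin; rewrite ler_piMr.
have iml i : (i < m)%N -> i%:R < n%:R * l.
  by move=> im; rewrite ltNge; apply/negP => /mmin; rewrite leqNgt im.
have mnl : m%:R <= n%:R * l + 1.
  case: m iml {nlm mmin mn} => [_|m /(_ m (ltnSn m))]; last by rewrite -natr1; lra.
  by have : 0 <= n%:R :> R by []; nra.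
(* Terms past [m] are nonnegative; the term at [m] is only known to be at least [- h k], which is
   charged once [j] exceeds [m]. *)
have tail j : (m <= j)%N ->
    \sum_(i < m) c n i - h k *+ (m < j)%N <= \sum_(i < j) c n i.
  elim: j => [|j IH]; first by rewrite leqn0 => /eqP ->; rewrite mulr0n subr0.
  rewrite leq_eqVlt ltnS => /predU1P[->|mj]; first by rewrite ltnn mulr0n subr0.
  rewrite mj mulr1n big_ord_recr/=; move: (IH mj).
  move: mj; rewrite leq_eqVlt => /predU1P[<-|mj].
    by rewrite ltnn mulr0n; have := profit_deductible_ge n m; lra.
  rewrite mj mulr1n.
  suff : 0 <= c n j by lra.
  by apply: profit_deductible_gt; rewrite (le_lt_trans nlm)// ltr_nat.
have := tail n mn; have := conjugate_le_sum n m iml a a0.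
have : h k *+ (m < n)%N <= h k by case: (m < n)%N; rewrite ?mulr1n ?mulr0n.
have := ler_wpM2r a0 nlm; have := ler_wpM2r h0 mnl.
lra.
Qed.

End Subgradient.
End Averaging.

(** * Integrated profits and optimality of stop-loss menus *)

Section Optimality.
Context d (K : measurableType d) (R : realType).
Context (Q : probability (R * K)%type R) (T : set (R * K)) (mT : measurable T).
Context (T_gt0 : forall z, T z -> 0 < z.1) (h : K -> R).
Context (h_ge0 : forall k, 0 <= h k).
Hypothesis phi_admissible : forall t : \bar R, (0 <= t)%E ->
  admissible Q T h (phi t) (optimal_rate h t).

(** With deductible [0] every type, being positive, is fully covered for free, so the profit of this
    admissible menu is minus the cost. *)
Lemma integrable_cost : Q.-integrable T (fun z => (h z.2)%:E).
Proof.
have b0 := phi_admissible 0%E (lexx _).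
have := integrableN b0; apply: eq_integrable => //.
move=> z /set_mem/T_gt0 z0; rewrite /= profit_phi /optimal_rate lte_fin z0.
by rewrite mul1r sub0r opprK.
Qed.

(** For a stop-loss utility the two integrands of [J] are the profit at the pointwise best rate;
    gluing them needs the measurability of [h], which [integrable_cost] supplies. *)
Lemma J_phi (t : \bar R) : (0 <= t)%E ->
  J Q T h (phi t) = J_menu Q T h (phi t) (optimal_rate h t).
Proof.
move=> t0; pose P := T `&` [set z | h z.2 <= z.1].
have mh : measurable_fun T (fun z => h z.2).
  by apply/measurable_EFinP; case/integrableP: integrable_cost.
have mP : measurable P.
  by apply: measurable_fun_le => //; exact: measurable_funTS.
have NE : [set z | T z /\ z.1 < h z.2] = T `\` P.
  apply/seteqP; split=> z /= [Tz]; rewrite ltNge.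
    by move=> /negP hz; split=> // -[].
  by move=> PNz; split=> //; apply/negP => hz; apply: PNz.
have TE : T = P `|` (T `\` P) by rewrite setDUK// => z [].
rewrite /J_menu [in RHS]TE integral_setU//; last 3 first.
- exact: measurableD.
- by rewrite -TE; case/integrableP: (phi_admissible t t0).
- by apply/disj_setPS => z [] ? [].
rewrite /J NE; congr (_ + _)%E; apply: eq_integral => z /set_mem [].
  move=> /T_gt0/ltW z0 hz; rewrite /profit -pointwise_best_rate_phi//.
  by rewrite /pointwise_best_rate hz.
move=> Tz PNz; rewrite /profit -pointwise_best_rate_phi//; last exact/ltW/T_gt0.
by rewrite /pointwise_best_rate; case: ifP => // hz; exfalso; apply: PNz.
Qed.

Lemma J_menu_le v lam (M : R) : quota_share_menu v lam ->
  admissible Q T h v lam ->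
  (forall t : \bar R, (0 <= t)%E ->
    (J_menu Q T h (phi t) (optimal_rate h t) <= M%:E)%E) ->
  (J_menu Q T h v lam <= M%:E)%E.
Proof.
move=> [Vv vlam] Gint phiM; pose G := profit h v lam.
pose c n i z := profit h (phi (deductible _ v n i))
  (optimal_rate h (deductible _ v n i)) z.
pose g n z := n.+1%:R^-1 * \sum_(i < n.+1) c n.+1 i z.
pose r n z := Num.max 0 (G z - g n z).
have cint n i : Q.-integrable T (EFin \o c n i).
  exact: phi_admissible (deductible_ge0 _ _ _ _).
have gE n : EFin \o g n =
    (fun z => n.+1%:R^-1%:E * \sum_(i < n.+1) (c n.+1 i z)%:E)%E.
  by apply/funext => z; rewrite sumEFin -EFinM.
have sint n : Q.-integrable T (fun z => \sum_(i < n.+1) (c n.+1 i z)%:E)%E.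
  by apply: integrable_sum => // i _; exact: cint.
have gint n : Q.-integrable T (EFin \o g n).
  by rewrite gE; apply: integrableZl.
(* The deductibles are the same for all types, so each term integrates to the value of one stop-loss
   menu and is bounded by [M]. *)
have gM n : (\int[Q]_(z in T) (g n z)%:E <= M%:E)%E.
  under eq_integral do rewrite [_%:E](congr1 (@^~ _) (gE n)).
  rewrite integralZl// integral_sum//; last by move=> i; exact: cint.
  rewrite -lee_pdivlMl// -EFinM invrK mulr_natl -[n.+1 in X in (_ <= X)%E]card_ord.
  rewrite -sumr_const -sumEFin; apply: lee_sum => i _.
  exact: phiM (deductible_ge0 _ _ _ _).
have Gg n z : T z -> G z - g n z <= n.+1%:R^-1 * (z.1 + 2 * h z.2).
  case: z => a k /T_gt0/= a0.
  have [lam01 slam] := vlam a k (ltW a0).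
  have /andP[l0 _] := lam01.
  have vl := (incentive_compatibleP Vv (ltW a0) l0).1 slam.
  have := profit_le_average _ _ Vv _ _ (ltW a0) vl _ h k (h_ge0 k) n.+1 lam01.
  rewrite -ler_pdivlMl// /G /g /profit/= => H.
  rewrite lerBlDl -mulrDr; exact: H.
have g_ge n z : T z -> - h z.2 <= g n z.
  case: z => a k /T_gt0/= a0.
  rewrite /g ler_pdivlMl// mulr_natl -[n.+1 in leLHS]card_ord -sumr_const.
  by apply: ler_sum => i _; apply: profit_deductible_ge; exact: h_ge0.
pose D z := (`|(G z)%:E| + (h z.2)%:E)%E.
have Dint : Q.-integrable T D.
  by apply: integrableD => //; [exact: integrable_abse|exact: integrable_cost].
have r_ge0 n z : 0 <= r n z by rewrite /r le_max lexx.
have rD n z : T z -> (`|(r n z)%:E| <= D z)%E.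
  move=> Tz; rewrite /D -EFinD lee_fin ger0_norm// /r ge_max.
  have := g_ge n z Tz; have := h_ge0 z.2; have := ler_norm (G z).
  have := normr_ge0 (G z); lra.
have mr n : measurable_fun T (EFin \o r n).
  rewrite (_ : _ \o _ = (fun z => maxe 0 ((G z)%:E - (g n z)%:E))%E); last first.
    by apply/funext => z; rewrite /= EFin_max.
  apply: measurable_maxe => //; apply: emeasurable_funB.
    by case/integrableP: Gint.
  by case/integrableP: (gint n).
have rint n : Q.-integrable T (EFin \o r n).
  apply: (le_integrable mT _ _ Dint) => // z Tz.
  by rewrite (le_trans (rD n z Tz))// lee_abs.
have Gr n : (J_menu Q T h v lam <= M%:E + \int[Q]_(z in T) (r n z)%:E)%E.
  apply: (@le_trans _ _ (\int[Q]_(z in T) ((g n z)%:E + (r n z)%:E)))%E.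
    apply: le_integral => //; first exact: (integrableD mT (gint n) (rint n)).
    move=> z _; rewrite -EFinD lee_fin -lerBlDl.
    by rewrite /r le_max lexx orbT.
  by rewrite (integralD mT (gint n) (rint n)); apply: leeD => //; exact: gM.
have r0 : (fun n => \int[Q]_(z in T) (r n z)%:E)%E @ \oo --> (0 : \bar R).
  have [] := @dominated_convergence _ _ _ Q T mT (fun n => EFin \o r n)
    (cst 0%E) D mr.
  - exact: measurable_cst.
  - apply: aeW => z Tz; apply: cvg_EFin; first exact: nearW.
    apply: (@squeeze_cvgr _ _ _ _ (cst 0) (fun n => n.+1%:R^-1 * (z.1 + 2 * h z.2))).
    + apply: nearW => n /=; rewrite r_ge0/= /r ge_max Gg// andbT.
      by rewrite mulr_ge0// addr_ge0// ?mulr_ge0// ltW// T_gt0.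
    + exact: cvg_cst.
    + rewrite -(mul0r (z.1 + 2 * h z.2)); apply: cvgMr_tmp.
      exact: cvg_harmonic.
  - exact: Dint.
  - by apply: aeW => z n Tz; exact: rD.
  by move=> _ _; rewrite integral0.
(* By [Gr] this sequence dominates a value independent of [n], which therefore lies below its
   limit. *)
have : (fun n => M%:E + \int[Q]_(z in T) (r n z)%:E)%E @ \oo --> (M%:E + 0)%E.
  by apply: cvgeD => //; exact: cvg_cst.
rewrite adde0.
by move=> /cvge_to_ge; apply; exact: nearW.
Qed.

End Optimality.

(** * Positivity of the types and the optimal menu *)

Lemma VaR_gt0 d (Om : measurableType d) (R : realType) (Pr : probability Om R)
    (X : {RV Pr >-> R}) (alpha : R) :
  0 < alpha -> (alpha%:E < 1 - cdf X 0)%E -> 0 < VaR X alpha.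
Proof.
move=> alpha0 alphaX.
have ccdf0 : (alpha%:E < ccdf X 0)%E.
  have cdf_fin : cdf X 0 \is a fin_num.
    by rewrite ge0_fin_numE ?cdf_ge0// (le_lt_trans (cdf_le1 X 0)) ?ltry.
  by move: alphaX; rewrite -(cdf_ccdf_1 X 0) addeAC subee// add0e.
(* Right continuity keeps the survival function above [alpha] up to some [e > 0], and by
   monotonicity [e] bounds the set in [VaR] from below. *)
have near0 : \forall x \near 0^'+, (alpha%:E < ccdf X x)%E.
  have /(_ [set y | alpha%:E < y]%E) := @ccdf_right_continuous _ _ _ _ X 0.
  by apply; apply: open_nbhs_nbhs; split => //; exact: open_ereal_gt_ereal.
(* This makes the set in [VaR] nonempty, without which [inf] would be its default value [0]. *)
have neary : \forall x \near +oo, (ccdf X x < alpha%:E)%E.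
  have /(_ [set y | y < alpha%:E]%E) := cvg_ccdfy0 X.
  apply; apply: open_nbhs_nbhs; split; first exact: open_ereal_lt_ereal.
  by rewrite /= lte_fin.
have [e [e0 eX]] := filter_ex (filterI (nbhs_right_gt 0) near0).
have [y yX] := filter_ex neary.
apply: (lt_le_trans e0); apply: lb_le_inf; first by exists y; exact: ltW.
move=> x /= xX; rewrite leNgt; apply/negP => xe.
by have := lt_le_trans eX (le_trans (ccdf_nonincreasing X (ltW xe)) xX); rewrite ltxx.
Qed.

Theorem theorem6p3 (R : realType) (d : measure_display) (Om : measurableType d)
    (Pr : probability Om R)
    (K : ptopologicalType) (polishK : polish_space R K)
    (X : K -> {RV Pr >-> R}) (regX : forall k, regular_loss (X k))
    (dom : set (Om -> R)) (H : (Om -> R) -> R) (theta : R)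
    (costH : cost_functional Pr dom H theta)
    (domX : forall k, dom (X k))
    (Tt : set (R * borel K)) (mTt : measurable Tt)
    (Tt01 : forall alpha k, Tt (alpha, k) -> 0 < alpha < 1)
    (Tt_proj : forall k, exists alpha, Tt (alpha, k))
    (Tt_jump : forall alpha k, Tt (alpha, k) ->
       (alpha%:E < 1 - cdf (X k) 0)%E)
    (m_iota : measurable_fun Tt (type_of X : R * borel K -> R * borel K))
    (T : set (R * borel K)) (defT : T = type_of X @` Tt) (mT : measurable T)
    (Qt : probability (R * borel K)%type R) (Qt_conc : Qt Tt = 1%E)
    (Q : probability (R * borel K)%type R)
    (defQ : forall A, measurable A -> Q A = Qt (Tt `&` type_of X @^-1` A)) :
  let h : borel K -> R := fun k => H (X k) in
  (* the integrand of J[phi_t] is measurable and integrable for each t *)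
  (forall t : \bar R, (0 <= t)%E ->
     admissible Q T h (phi t) (pointwise_best_rate h (phi t))) ->
  forall tau : \bar R, (0 <= tau)%E ->
  (forall t : \bar R, (0 <= t)%E ->
     (J Q T h (phi t) <= J Q T h (phi tau))%E) ->
  [/\ quota_share_menu (phi tau) (optimal_rate h tau),
      admissible Q T h (phi tau) (optimal_rate h tau),
      forall (v : R -> R) (lam : R * borel K -> R),
        quota_share_menu v lam -> admissible Q T h v lam ->
        (J_menu Q T h v lam <=
         J_menu Q T h (phi tau) (optimal_rate h tau))%E &
      forall (a : R) (k : borel K), 0 <= a ->
        (premium (phi tau) (optimal_rate h tau) (a, k))%:E =
        optimal_premium h tau (a, k)].
Proof.
move=> h phi_adm tau tau0 tau_max.
have T_gt0 z : T z -> 0 < z.1.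
  rewrite defT => -[[alpha k] Ttz <-] /=.
  by have /andP[? _] := Tt01 _ _ Ttz; apply: VaR_gt0 => //; exact: Tt_jump.
have h_ge0 k : 0 <= h k.
  by apply: (cost_ge0 costH) => //; case: (regX k).
have adm t : (0 <= t)%E -> admissible Q T h (phi t) (optimal_rate h t).
  move=> t0; apply: eq_integrable (phi_adm t t0) => //.
  by move=> z /set_mem/T_gt0/ltW z0; rewrite /= /profit pointwise_best_rate_phi.
split.
- exact: optimal_rate_menu.
- exact: adm.
- move=> v lam vlam vlam_adm.
  (* Finiteness lets the value at [tau] serve as the real bound [M] of [J_menu_le]. *)
  have Jfin : J_menu Q T h (phi tau) (optimal_rate h tau) \is a fin_num.
    by apply: integrable_fin_num => //; exact: adm.
  rewrite -(fineK Jfin); apply: J_menu_le => // t t0.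
  rewrite (fineK Jfin).
  (* The maximality of [tau] is stated for [J] and has to be carried over to [J_menu]. *)
  have JE := J_phi _ _ _ _ _ mT T_gt0 h adm.
  by rewrite -!JE//; exact: tau_max.
- by move=> a k a0; exact: premium_phi.
Qed.
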